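(* Let $H$ be a motif on $k$ vertices and let $\mathcal{D}_n$ be a distribution over graphs on $n$ vertices satisfying: (1) for $G\sim\mathcal{D}_n$, for all $\ell\in[k]$ and all (labeled, induced) subgraphs $P\subseteq H$ on $\ell$ vertices, the number of labeled induced copies of $P$ in $G$ lies in $(1\pm\frac{\varepsilon}{100})E_{\mathcal{D}_n}(P)$ with high constant probability; (2) for all $\ell\in\{2,3,\dots,k\}$, $r_\ell(H)\le (4/9)\, r_{\ell-1}(H)$. Then there exists an algorithm for the $(\mathcal{D}_n,\rho_H)$-quality control problem that uses $\widetilde{O}\left(r_k(H)^{-2}\right)$ adjacency matrix queries to the input graph.
   Context: Quality control: let $\mathcal{X}$ be a set, $\rho:\mathcal{X}\to\mathbb{R}_{\ge 0}$, $\varepsilon>0$ a fixed small constant, and $\mathcal{D}$ a distribution on $\mathcal{X}$ with $\Pr_{x\sim\mathcal{D}}[|\rho(x)-1|\le\varepsilon]\ge 9/10$. A (randomized) $(\mathcal{D},\rho)$-quality control algorithm $A$ must satisfy: (i) $\Pr_{x\sim\mathcal{D},R}[A(x)=\textsc{Accept}]\ge 2/3$, where $R$ is the algorithm's internal randomness; (ii) for every $x$ with $|\rho(x)-1|>\varepsilon$, $\Pr_R[A(x)=\textsc{Reject}]\ge 2/3$. Inputs are $n$-vertex graphs accessed via adjacency matrix queries. For a motif $P$ on $\ell$ vertices, $C_P(G)$ is the number of labeled induced copies of $P$ in $G$ (injective maps $\psi:V(P)\to V(G)$ with $\{\psi(u),\psi(v)\}\in E(G)$ iff $\{u,v\}\in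 E(P)$); $E_{\mathcal{D}_n}(P)=\mathbb{E}_{G\sim\mathcal{D}_n}[C_P(G)] = \binom{n}{\ell}\ell!\cdot F_{\mathcal{D}_n}(P)$, which defines the density $F_{\mathcal{D}_n}(P)$. For $1\le\ell\le k$ let $\mathcal{H}_\ell$ be the set of labeled induced subgraphs of $H$ on $\ell$ vertices, and define the density increment $r_\ell(H)=\min_{H_1\in\mathcal{H}_\ell} F_{\mathcal{D}_n}(H_1)^2/\max_{H_2\subseteq H_1,|H_2|=\ell-1}F_{\mathcal{D}_n}(H_2)^2$ (the max over induced subgraphs $H_2$ of $H_1$ on $\ell-1$ vertices). $\rho_H(G)=C_H(G)/\mathbb{E}_{G'\sim\mathcal{D}_n}[C_H(G')]$. *)

(* Defs.v *)
From HB Require Import structures.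
From mathcomp Require Import all_boot all_order all_algebra.
From mathcomp Require Import classical_sets reals exp.

Set Implicit Arguments.
Unset Strict Implicit.
Unset Printing Implicit Defensive.

Import Order.TTheory GRing.Theory Num.Theory.
Local Open Scope ring_scope.

Record fdist (R : realType) (T : finType) := FDist {
  fdist_fun :> T -> R;
  fdist_ge0 : forall x, 0 <= fdist_fun x;
  fdist_sum1 : \sum_x fdist_fun x = 1 }.

Definition Pr (R : realType) (T : finType) (D : fdist R T) (P : pred T) : R :=
  \sum_(x | P x) D x.

Definition expect (R : realType) (T : finType) (D : fdist R T) (f : T -> R)
    : R :=
  \sum_x D x * f x.

Record sgraph (V : finType) := SGraph {
  edges : {set {set V}};
  edges_card2 : [forall e in edges, #|e| == 2%N] }.

HB.instance Definition _ (V : finType) := [isSub for @edges V].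
HB.instance Definition _ (V : finType) := [Equality of sgraph V by <:].
HB.instance Definition _ (V : finType) := [Choice of sgraph V by <:].
HB.instance Definition _ (V : finType) := [Countable of sgraph V by <:].
HB.instance Definition _ (V : finType) := [Finite of sgraph V by <:].

(* [set u; u] is a singleton, hence never an edge: adj G is irreflexive. *)
Definition adj (V : finType) (G : sgraph V) (u v : V) : bool :=
  [set u; v] \in edges G.

Definition induced_edges (V : finType) (H : sgraph V) (S : {set V})
    : {set {set {x | x \in S}}} :=
  [set e : {set {x | x \in S}} | [set val x | x in e] \in edges H].

Fact induced_edges_card2 (V : finType) (H : sgraph V) (S : {set V}) :
  [forall e in induced_edges H S, #|e| == 2%N].
Proof.
apply/forall_inP => e; rewrite inE => He.
by have /forall_inP/(_ _ He) := edges_card2 H; rewrite card_imset //; apply: val_inj.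
Qed.

Definition induced (V : finType) (H : sgraph V) (S : {set V})
    : sgraph {x | x \in S} :=
  SGraph (induced_edges_card2 H S).

Definition num_copies (V W : finType) (P : sgraph V) (G : sgraph W) : nat :=
  #|[set psi : {ffun V -> W} | injectiveb psi &&
       [forall u, forall v, adj G (psi u) (psi v) == adj P u v]]|.

Definition exp_copies (R : realType) (n : nat) (D : fdist R (sgraph 'I_n))
    (V : finType) (P : sgraph V) : R :=
  expect D (fun G => (num_copies P G)%:R).

Definition density (R : realType) (n : nat) (D : fdist R (sgraph 'I_n))
    (V : finType) (P : sgraph V) : R :=
  exp_copies D P / ('C(n, #|V|) * (#|V|)`!)%N%:R.

(* An induced subgraph of H is given by its vertex set S.  The sup and the inf
   below range over finite families, nonempty when 1 <= l <= k, so that they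
   are a max and a min.  For l = 1 the only smaller subgraph is the empty one,
   whose density is 1. *)
Definition max_sub_density_sq (R : realType) (n : nat)
    (D : fdist R (sgraph 'I_n)) (k : nat) (H : sgraph 'I_k) (S : {set 'I_k})
    (m : nat) : R :=
  sup [set density D (induced H T) ^+ 2
      | T in [set T : {set 'I_k} | T \subset S /\ #|T| = m]]%classic.

Definition density_incr (R : realType) (n : nat) (D : fdist R (sgraph 'I_n))
    (k : nat) (H : sgraph 'I_k) (l : nat) : R :=
  inf [set density D (induced H S) ^+ 2 / max_sub_density_sq D H S l.-1
      | S in [set S : {set 'I_k} | #|S| = l]]%classic.

Definition quality (R : realType) (n : nat) (D : fdist R (sgraph 'I_n))
    (k : nat) (H : sgraph 'I_k) (G : sgraph 'I_n) : R :=
  (num_copies H G)%:R / exp_copies D H.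

Definition quality_promise (R : realType) (X : finType) (D : fdist R X)
    (rho : X -> R) (eps : R) : Prop :=
  9 / 10 <= Pr D (fun x => `|rho x - 1| <= eps).

(* [A w x] is the output on input x with internal randomness w, drawn from mu;
   true stands for Accept and false for Reject. *)
Definition quality_control (R : realType) (X W : finType) (D : fdist R X)
    (rho : X -> R) (eps : R) (mu : fdist R W) (A : W -> X -> bool) : Prop :=
  2 / 3 <= \sum_(p : X * W | A p.2 p.1) D p.1 * mu p.2 /\
  (forall x, eps < `|rho x - 1| -> 2 / 3 <= Pr mu (fun w => ~~ A w x)).

(* Deterministic adaptive algorithms with adjacency matrix queries: the two
   subtrees of [Query u v] are followed when uv is, resp. is not, an edge. *)
Inductive query_tree (n : nat) : Type :=
| Output of bool
| Query of 'I_n & 'I_n & query_tree n & query_tree n.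

Fixpoint run (n : nat) (t : query_tree n) (G : sgraph 'I_n) : bool :=
  match t with
  | Output b => b
  | Query u v t1 t0 => if adj G u v then run t1 G else run t0 G
  end.

Fixpoint num_queries (n : nat) (t : query_tree n) (G : sgraph 'I_n) : nat :=
  match t with
  | Output _ => 0%N
  | Query u v t1 t0 =>
      (if adj G u v then num_queries t1 G else num_queries t0 G).+1
  end.

Record query_alg (R : realType) (n : nat) := QueryAlg {
  coins : finType;
  coin_dist : fdist R coins;
  strategy : coins -> query_tree n }.

Arguments strategy {R n} q _.

(* Concentration of all the counts simultaneously, with probability 9/10. *)
Definition counts_concentrated (R : realType) (n : nat)
    (D : fdist R (sgraph 'I_n)) (k : nat) (H : sgraph 'I_k) (eps : R) : Prop :=
  9 / 10 <= Pr D (fun G => [forall S : {set 'I_k}, (1 <= #|S| <= k)%N ==>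
    (`|(num_copies (induced H S) G)%:R - exp_copies D (induced H S)|
       <= eps / 100 * exp_copies D (induced H S))]).

(* The bound hidden in O~(f) for f >= 1; the summand 1 only matters for f
   close to 1, where ln f vanishes. *)
Definition soft_bound (R : realType) (C : R) (c : nat) (f : R) : R :=
  C * f * (1 + ln f) ^+ c.

(* Main.v *)
(* Sample k batches of s uniform vertices each, query all pairs among them, and
   for every vertex set T of H estimate the density p_T of copies of H[T] by the
   fraction of transversals of the batches that are copies.  Two transversals
   agreeing on J inside T are both copies of H[T] with probability at most
   p_T p_(T \ J), because the part of the second one outside J is independent of
   the first.  Hence the variance is at most the sum over nonempty J of
   p_T p_(T \ J) / s^|J|.  Telescoping the density increments gives
   e_(T \ J) <= k^k Q^|J| e_T for the expected densities e, with Q = 1 / r_k, so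
   s = O(Q) makes every relative variance small as soon as p_U = O(e_U) for the
   proper subsets U of T.  The tester accepts when all estimates are close to
   the e_T.  On a bad input, a minimal T with p_T too large, or else T = V(H),
   has an accurate estimate and triggers rejection.  This costs
   (k s)^2 = O(Q^2) queries, without logarithmic factors. *)
Require Import Defs.
From mathcomp Require Import all_boot all_order all_algebra.
From mathcomp Require Import classical_sets reals.
From mathcomp Require Import zify ring lra.

Set Implicit Arguments.
Unset Strict Implicit.
Unset Printing Implicit Defensive.

Import Order.TTheory GRing.Theory Num.Theory.
Local Open Scope ring_scope.

(** * Averages over finite types: independence and Chebyshev's inequality *)

Definition avg (R : realFieldType) (T : finType) (f : T -> R) : R :=
  (\sum_x f x) / #|T|%:R.

Section Average.
Variable R : realFieldType.

Lemma eq_avg (T : finType) (f g : T -> R) : f =1 g -> avg f = avg g.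
Proof. by move=> fg; rewrite /avg (eq_bigr g). Qed.

Lemma le_avg (T : finType) (f g : T -> R) :
  (forall x, f x <= g x) -> avg f <= avg g.
Proof. by move=> fg; rewrite /avg ler_wpM2r ?invr_ge0 ?ler0n ?ler_sum. Qed.

Lemma avg_ge0 (T : finType) (f : T -> R) : (forall x, 0 <= f x) -> 0 <= avg f.
Proof. by move=> f0; rewrite /avg divr_ge0 ?ler0n ?sumr_ge0. Qed.

Lemma avg_cst (T : finType) (c : R) : (0 < #|T|)%N -> avg (fun _ : T => c) = c.
Proof.
move=> T0; rewrite /avg sumr_const -(mulr_natr c) mulfK //.
by rewrite pnatr_eq0 -lt0n.
Qed.

Lemma avgD (T : finType) (f g : T -> R) :
  avg (fun x => f x + g x) = avg f + avg g.
Proof. by rewrite /avg big_split mulrDl. Qed.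

Lemma avgZ (T : finType) (c : R) (f : T -> R) :
  avg (fun x => c * f x) = c * avg f.
Proof. by rewrite /avg -mulr_sumr mulrA. Qed.

Lemma avg_sum (T I : finType) (P : pred I) (f : I -> T -> R) :
  avg (fun x => \sum_(i | P i) f i x) = \sum_(i | P i) avg (f i).
Proof. by rewrite /avg exchange_big -mulr_suml. Qed.

Lemma avg_exchange (T U : finType) (f : T -> U -> R) :
  avg (fun x => avg (f x)) = avg (fun y => avg (f^~ y)).
Proof.
by rewrite /avg -!mulr_suml exchange_big /= mulrAC.
Qed.

Lemma avg_mul (T U : finType) (f : T -> R) (g : U -> R) :
  avg f * avg g = avg (fun x => avg (fun y => f x * g y)).
Proof.
under [RHS]eq_avg => x do rewrite avgZ mulrC.
by rewrite avgZ mulrC.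
Qed.

Lemma avg_pair (T U : finType) (f : T * U -> R) :
  avg f = avg (fun x => avg (fun y => f (x, y))).
Proof.
rewrite /avg -mulr_suml pair_big card_prod natrM invfM mulrA mulrAC.
by congr (_ / _ / _); apply: eq_bigr => -[].
Qed.

Lemma avg_indicator (T : finType) (P : pred T) :
  avg (fun x => (P x)%:R) = #|P|%:R / #|T|%:R :> R.
Proof. by rewrite /avg -natr_sum -big_mkcond /= sum1_card. Qed.

Lemma avg_involution (T : finType) (h : T -> T) (f : T -> R) :
  involutive h -> avg (fun x => f (h x)) = avg f.
Proof. by move=> hK; rewrite /avg [in RHS](reindex_inj (inv_inj hK)). Qed.

Lemma card_ffun_gt0 (I X : finType) : (0 < #|X|)%N -> (0 < #|{ffun I -> X}|)%N.
Proof. by move=> X0; rewrite card_ffun expn_gt0 X0. Qed.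

(* Exchanging the values of w along sigma with those of an independent x is an
   involution, so both have the same law; no fibre has to be counted. *)
Lemma avg_restrict (I J X : finType) (sigma : I -> J) (f : {ffun I -> X} -> R) :
  injective sigma -> (0 < #|X|)%N ->
  avg (fun w : {ffun J -> X} => f [ffun i => w (sigma i)]) = avg f.
Proof.
move=> sI X0.
pose h (p : {ffun J -> X} * {ffun I -> X}) : {ffun J -> X} * {ffun I -> X} :=
  ([ffun j => if [pick i | sigma i == j] is Some i then p.2 i else p.1 j],
   [ffun i => p.1 (sigma i)]).
have hK : involutive h.
  move=> [w x]; rewrite /h /=; congr pair; apply/ffunP => i; rewrite !ffunE.
    by case: pickP => [j /eqP <-|]; rewrite ?ffunE.
  by case: pickP => [j /eqP/sI ->|/(_ i)] //; rewrite eqxx.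
transitivity (avg (fun p : {ffun J -> X} * {ffun I -> X} => f (h p).2)).
  by rewrite avg_pair; apply: eq_avg => w /=; rewrite avg_cst // card_ffun_gt0.
rewrite (avg_involution (fun p => f p.2) hK) avg_pair /=.
by rewrite avg_cst // card_ffun_gt0.
Qed.

(** Swapping the coordinates outside [A] between two independent samples is an involution. It turns
    [f w * g w], evaluated at the first mixed sample, into [f w * g w'], whose average factors. *)
Lemma avg_indep (I X : finType) (A : {set I}) (f g : {ffun I -> X} -> R) :
  (0 < #|X|)%N ->
  (forall w w' : {ffun I -> X}, {in A, w =1 w'} -> f w = f w') ->
  (forall w w' : {ffun I -> X}, {in ~: A, w =1 w'} -> g w = g w') ->
  avg (fun w => f w * g w) = avg f * avg g.
Proof.
move=> X0 fA gA.
pose mix (w w' : {ffun I -> X}) : {ffun I -> X} :=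
  [ffun i => if i \in A then w i else w' i].
pose h (p : {ffun I -> X} * {ffun I -> X}) := (mix p.1 p.2, mix p.2 p.1).
have hK : involutive h.
  move=> [w w']; rewrite /h /mix /=; congr pair; apply/ffunP => i;
    by rewrite !ffunE; case: (i \in A).
rewrite avg_mul.
transitivity (avg (fun p : {ffun I -> X} * {ffun I -> X} =>
    f (h p).1 * g (h p).1)).
  rewrite (avg_involution (fun p => f p.1 * g p.1) hK) avg_pair /=.
  by apply: eq_avg => w; rewrite avg_cst // card_ffun_gt0.
rewrite avg_pair; apply: eq_avg => w; apply: eq_avg => w' /=.
congr (_ * _); first by apply: fA => i iA; rewrite ffunE iA.
by apply: gA => i; rewrite inE ffunE => /negPf ->.
Qed.

(** The restriction of a uniform [b] to [J] is uniform among [#|X| ^ #|J|] functions, and exactly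
    one of them is the restriction of [a]. *)
Lemma avg_agree (I X : finType) (J : {set I}) (a : {ffun I -> X}) :
  (0 < #|X|)%N ->
  avg (fun b : {ffun I -> X} => [forall i in J, b i == a i]%:R)
    = #|X|%:R ^- #|J| :> R.
Proof.
move=> X0; pose f (b : {ffun {i | i \in J} -> X}) : R :=
  (b == [ffun i => a (val i)])%:R.
transitivity (avg f).
  rewrite -(avg_restrict f val_inj X0); apply: eq_avg => b; congr (_%:R).
  congr nat_of_bool.
  apply/forall_inP/eqP => [E|/ffunP E i iJ].
    by apply/ffunP => -[i iJ]; rewrite !ffunE /=; apply/eqP/E.
  by have := E (Sub i iJ); rewrite !ffunE /= => ->.
rewrite [LHS](avg_indicator (pred1 [ffun i => a (val i)])) card1.
by rewrite card_ffun card_sig natrX div1r.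
Qed.

Lemma chebyshev_avg (T : finType) (Z : T -> R) (p t : R) : 0 < t ->
  avg (fun x => (t <= `|Z x - p|)%R%:R) <= avg (fun x => (Z x - p) ^+ 2) / t ^+ 2.
Proof.
move=> t0; rewrite mulrC -avgZ; apply: le_avg => x.
have t20 : 0 < t ^+ 2 by rewrite exprn_gt0.
case: (lerP t) => [tZ|_] /=.
  by rewrite mulrC ler_pdivlMr // mul1r -[leRHS]real_normK ?num_real //
    lerXn2r ?nnegrE ?(ltW t0).
by rewrite mulr_ge0 ?sqr_ge0 // invr_ge0 ltW.
Qed.

End Average.

(** * Transversal estimates of a local, monotone property, and their variance *)

Section SampledCopies.
Variables (R : realFieldType) (I X S : finType).
Variable c : {set I} -> {ffun I -> X} -> bool.
Hypotheses (X_gt0 : (0 < #|X|)%N) (S_gt0 : (0 < #|S|)%N).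
Hypothesis c_local : forall (T : {set I}) (x y : {ffun I -> X}),
  {in T, x =1 y} -> c T x = c T y.
Hypothesis c_mono : forall (T U : {set I}) x, U \subset T -> c T x -> c U x.

Definition hit_prob (T : {set I}) : R := avg (fun x => (c T x)%:R).

(** [w (i, t)] is sample [t] of batch [i], and [a] selects one sample from each batch. *)
Definition pick_tuple (w : {ffun I * S -> X}) (a : {ffun I -> S})
    : {ffun I -> X} := [ffun i => w (i, a i)].

Definition estimate (T : {set I}) (w : {ffun I * S -> X}) : R :=
  avg (fun a => (c T (pick_tuple w a))%:R).

Lemma hit_prob_ge0 T : 0 <= hit_prob T.
Proof. exact: avg_ge0. Qed.

Lemma le_hit_prob (T U : {set I}) : U \subset T -> hit_prob T <= hit_prob U.
Proof.
move=> UT; apply: le_avg => x; rewrite ler_nat.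
by case E: (c T x) => //; rewrite (c_mono UT E).
Qed.

(** Distinct batches use distinct coordinates of [w], so a picked tuple is uniform whatever [a]
    is. *)
Lemma avg_pick_tuple T a :
  avg (fun w => (c T (pick_tuple w a))%:R) = hit_prob T.
Proof.
by apply: (avg_restrict (sigma := fun i => (i, a i)) (fun x => (c T x)%:R))
  => // i j [].
Qed.

Lemma avg_estimate T : avg (estimate T) = hit_prob T.
Proof.
rewrite avg_exchange; under eq_avg => a do rewrite avg_pick_tuple.
by rewrite avg_cst // card_ffun_gt0.
Qed.

(* Two tuples agreeing exactly on J use disjoint coordinates on T and T :\: J,
   and the second one only needs to be a copy on T :\: J. *)
Lemma joint_hit T a b :
  avg (fun w => (c T (pick_tuple w a))%:R * (c T (pick_tuple w b))%:R)
    <= hit_prob T * hit_prob (T :\: [set i | b i == a i]).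
Proof.
set U := T :\: _.
pose A : {set I * S} := [set p | (p.1 \in T) && (a p.1 == p.2)].
apply: (@le_trans _ _ (avg (fun w => (c T (pick_tuple w a))%:R *
    (c U (pick_tuple w b))%:R))).
  apply: le_avg => w; rewrite ler_wpM2l ?ler0n // ler_nat.
  by case E: (c T _) => //; rewrite (c_mono (subsetDl _ _) E).
rewrite (avg_indep (A := A)) ?avg_pick_tuple // => w w' E; congr (_%:R).
  congr nat_of_bool; apply: c_local => i iT.
  by rewrite !ffunE E // inE iT eqxx.
congr nat_of_bool; apply: c_local => i; rewrite !inE => /andP[ba iT].
by rewrite !ffunE E // !inE iT /= eq_sym.
Qed.

(** The second moment is an average over pairs [a], [b]. For fixed [a], the pairs are classified by
    the subset of [T] where they agree; the empty subset contributes at most the square of the mean,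
    which cancels. *)
Lemma variance_estimate T :
  avg (fun w => (estimate T w - hit_prob T) ^+ 2)
    <= \sum_(J : {set I} | (J != finset.set0) && (J \subset T))
         hit_prob T * hit_prob (T :\: J) * #|S|%:R ^- #|J|.
Proof.
set p := hit_prob T.
have W0 : (0 < #|{ffun I * S -> X}|)%N by rewrite card_ffun_gt0.
have A0 : (0 < #|{ffun I -> S}|)%N by rewrite card_ffun_gt0.
have -> : avg (fun w => (estimate T w - p) ^+ 2) =
    avg (fun w => estimate T w ^+ 2) - p ^+ 2.
  under eq_avg => w.
    rewrite (_ : _ ^+ 2 = estimate T w ^+ 2 + (- 2 * p * estimate T w + p ^+ 2));
      last by ring.
    over.
  rewrite !avgD avgZ avg_cst // avg_estimate -/p; ring.
rewrite lerBlDr.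
under eq_avg => w do rewrite expr2 avg_mul.
rewrite avg_exchange; under eq_avg => a do rewrite avg_exchange.
rewrite -[leRHS](avg_cst _ A0); apply: le_avg => a.
(* Summing over all [J] on which [a] and [b] agree overcounts, but the terms are nonnegative and the
   exact agreement set is among them. The events for fixed [J] have the simple probability of
   [avg_agree]. *)
pose g (b : {ffun I -> S}) : R :=
  \sum_(J : {set I} | (J != finset.set0) && (J \subset T))
  p * hit_prob (T :\: J) * [forall i in J, b i == a i]%:R + p ^+ 2.
apply: (@le_trans _ _ (avg g)); last first.
  rewrite avgD avg_cst // avg_sum; under eq_bigr do rewrite avgZ avg_agree //.
  by [].
apply: le_avg => b; apply: le_trans (joint_hit T a b) _; rewrite -/p /g.
pose J := [set i in T | b i == a i].
have -> : T :\: [set i | b i == a i] = T :\: J.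
  by apply/setP => i; rewrite !inE; case: (i \in T); rewrite ?andbF ?andbT.
have g0 (K : {set I}) :
    0 <= p * hit_prob (T :\: K) * [forall i in K, b i == a i]%:R.
  by do 2?apply: mulr_ge0; rewrite ?ler0n //; exact: hit_prob_ge0.
have [->|J0] := eqVneq J finset.set0.
  by rewrite finset.setD0 expr2 lerDr sumr_ge0.
rewrite (bigD1 J) /=; last first.
  by rewrite J0 /=; apply/fintype.subsetP => i; rewrite inE => /andP[].
rewrite (_ : [forall i in J, _]); last first.
  by apply/forall_inP => i; rewrite inE => /andP[].
rewrite mulr1 -addrA lerDl addr_ge0 ?sqr_ge0 //.
by rewrite sumr_ge0.
Qed.

End SampledCopies.

(** * Copies of induced subgraphs inside maps on all of [V] *)

Definition is_copy (V W : finType) (P : sgraph V) (G : sgraph W)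
    (psi : {ffun V -> W}) : bool :=
  injectiveb psi && [forall u, forall v, adj G (psi u) (psi v) == adj P u v].

(** Stated for total maps, of which only the values on [T] matter, so that all [T] share one sample
    space. *)
Definition copy_on (V W : finType) (H : sgraph V) (G : sgraph W) (T : {set V})
    (x : {ffun V -> W}) : bool :=
  is_copy (induced H T) G [ffun i => x (val i)].

Section Copies.
Variables (V W : finType) (H : sgraph V) (G : sgraph W).
Implicit Types (T U : {set V}) (x y : {ffun V -> W}).

Lemma adj_induced T (u v : {i | i \in T}) :
  adj (induced H T) u v = adj H (val u) (val v).
Proof. by rewrite /adj inE imsetU1 imset_set1. Qed.

Lemma copy_onP T x :
  reflect ({in T &, injective x} /\
           {in T &, forall u v, adj G (x u) (x v) = adj H u v})
          (copy_on H G T x).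
Proof.
apply: (iffP andP) => [[/injectiveP xI /forallP xA]|[xI xA]]; split.
- move=> u v uT vT xuv; have := xI (Sub u uT) (Sub v vT).
  by rewrite !ffunE /= => /(_ xuv) [].
- move=> u v uT vT.
  have /forallP/(_ (Sub v vT))/eqP := xA (Sub u uT).
  by rewrite !ffunE adj_induced.
- apply/injectiveP => u v; rewrite !ffunE => xuv; apply: val_inj.
  by apply: xI xuv; apply: valP.
- apply/forallP => u; apply/forallP => v; apply/eqP.
  by rewrite !ffunE adj_induced; apply: xA; apply: valP.
Qed.

Lemma copy_on_local T x y :
  {in T, x =1 y} -> copy_on H G T x = copy_on H G T y.
Proof.
move=> xy; rewrite /copy_on; congr is_copy; apply/ffunP => i; rewrite !ffunE.
exact/xy/valP.
Qed.

Lemma copy_on_mono T U x :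
  U \subset T -> copy_on H G T x -> copy_on H G U x.
Proof.
move=> /fintype.subsetP UT /copy_onP[xI xA]; apply/copy_onP.
by split=> u v /UT uT /UT vT; [apply: xI | apply: xA].
Qed.

Lemma copy_on_setT x : copy_on H G [set: V]%SET x = is_copy H G x.
Proof.
apply/copy_onP/andP => -[xI xA]; split.
- by apply/injectiveP => u v; apply: xI; rewrite finset.in_setT.
- by apply/forallP => u; apply/forallP => v; apply/eqP/xA; rewrite finset.in_setT.
- by move=> u v _ _; move/injectiveP: xI; apply.
- by move=> u v _ _; move/forallP/(_ u)/forallP/(_ v)/eqP: xA.
Qed.

Lemma avg_is_copy (R : realFieldType) :
  avg (fun x => (is_copy H G x)%:R) =
    (num_copies H G)%:R / #|W|%:R ^+ #|V| :> R.
Proof. by rewrite avg_indicator /num_copies cardsE card_ffun natrX. Qed.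

Lemma num_copies_le_ffact : (num_copies H G <= #|W| ^_ #|V|)%N.
Proof.
rewrite -card_inj_ffuns; apply: subset_leq_card; apply/fintype.subsetP => x.
by rewrite !inE => /andP[].
Qed.

End Copies.

(** * Copy counts as probabilities under a uniform map *)

Section CopyProbability.
Variables (R : realFieldType) (V W : finType) (H : sgraph V) (G : sgraph W).
Hypothesis W_gt0 : (0 < #|W|)%N.

Definition copy_prob (T : {set V}) : R := hit_prob R (copy_on H G) T.

Lemma copy_probE T :
  copy_prob T = (num_copies (induced H T) G)%:R / #|W|%:R ^+ #|T|.
Proof.
have -> : #|T| = #|{: {i | i \in T}}| by rewrite card_sig.
rewrite -avg_is_copy; apply: (avg_restrict (sigma := val)) W_gt0.
exact: val_inj.
Qed.

Lemma copy_prob_setT :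
  copy_prob [set: V]%SET = (num_copies H G)%:R / #|W|%:R ^+ #|V|.
Proof.
by rewrite -avg_is_copy; apply: eq_avg => x; rewrite copy_on_setT.
Qed.

Lemma copy_prob_set0 : copy_prob finset.set0 = 1.
Proof.
rewrite -[RHS](@avg_cst R {ffun V -> W}) ?card_ffun_gt0 //; apply: eq_avg => x.
suff -> : copy_on H G finset.set0 x by [].
by apply/copy_onP; split=> u v; rewrite finset.in_set0.
Qed.

End CopyProbability.

(** * Expected densities and the telescoping of density increments *)

Section Density.
Variables (R : realType) (k n : nat) (H : sgraph 'I_k).
Variable D : fdist R (sgraph 'I_n).
Hypothesis EH_gt0 : 0 < exp_copies D H.
Implicit Types S T U J : {set 'I_k}.

Definition exp_copy_prob T : R := expect D (fun G => copy_prob R H G T).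

Lemma le_expect (X : finType) (E : fdist R X) (f g : X -> R) :
  (forall x, f x <= g x) -> expect E f <= expect E g.
Proof. by move=> fg; apply: ler_sum => x _; rewrite ler_wpM2l ?fdist_ge0. Qed.

Lemma expect_cst (X : finType) (E : fdist R X) c : expect E (fun _ => c) = c.
Proof. by rewrite /expect -mulr_suml fdist_sum1 mul1r. Qed.

Lemma expectMr (X : finType) (E : fdist R X) (f : X -> R) c :
  expect E (fun x => f x * c) = expect E f * c.
Proof. by rewrite /expect mulr_suml; apply: eq_bigr => x _; rewrite mulrA. Qed.

Lemma exp_copies_le_ffact (V : finType) (P : sgraph V) :
  exp_copies D P <= (n ^_ #|V|)%:R.
Proof.
rewrite -[leRHS](expect_cst D); apply: le_expect => G.
by rewrite ler_nat -[n in n ^_ _]card_ord num_copies_le_ffact.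
Qed.

Lemma motif_size_le : (k <= n)%N.
Proof.
have := lt_le_trans EH_gt0 (exp_copies_le_ffact H).
by rewrite ltr0n ffact_gt0 card_ord.
Qed.

Hypothesis k_gt0 : (0 < k)%N.

Let n_gt0 : (0 < n)%N := leq_trans k_gt0 motif_size_le.

Let n_exp_gt0 l : 0 < n%:R ^+ l :> R.
Proof. by rewrite exprn_gt0 // ltr0n. Qed.

Let ord_gt0 : (0 < #|'I_n|)%N. Proof. by rewrite card_ord. Qed.

Lemma exp_copy_probE T :
  exp_copy_prob T = exp_copies D (induced H T) / n%:R ^+ #|T|.
Proof.
rewrite /exp_copies -expectMr; apply: eq_bigr => G _.
by rewrite copy_probE // card_ord.
Qed.

Lemma exp_copy_prob_setT :
  exp_copy_prob [set: 'I_k]%SET = exp_copies D H / n%:R ^+ k.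
Proof.
rewrite /exp_copies -expectMr; apply: eq_bigr => G _.
by rewrite copy_prob_setT // !card_ord.
Qed.

Lemma exp_copy_prob_set0 : exp_copy_prob finset.set0 = 1.
Proof.
rewrite -[RHS](expect_cst D); apply: eq_bigr => G _.
by rewrite copy_prob_set0.
Qed.

(** A copy of [H] restricts to a copy on [T], so positivity is inherited from the full vertex
    set. *)
Lemma exp_copy_prob_gt0 T : 0 < exp_copy_prob T.
Proof.
apply: (@lt_le_trans _ _ (exp_copy_prob [set: 'I_k]%SET)).
  by rewrite exp_copy_prob_setT divr_gt0.
apply: le_expect => G; apply: le_hit_prob; last exact: finset.subsetT.
exact: copy_on_mono.
Qed.

Lemma ffact_le_exp (m l : nat) : (m ^_ l <= m ^ l)%N.
Proof.
by elim: l => // l IH; rewrite ffactnSr expnSr leq_mul // leq_subr.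
Qed.

(** Factor by factor: [m <= k * (m - i)] for [i < k <= m]. *)
Lemma exp_le_ffact (m l : nat) :
  (l <= k)%N -> (k <= m)%N -> (m ^ l <= k ^ l * m ^_ l)%N.
Proof.
move=> lk km; elim: l lk => // l IH lk.
rewrite ffactnSr !expnSr mulnACA leq_mul ?IH ?(ltnW lk) //.
nia.
Qed.

Lemma ffact_natr_gt0 l : (l <= k)%N -> 0 < (n ^_ l)%:R :> R.
Proof. by move=> lk; rewrite ltr0n ffact_gt0 (leq_trans lk motif_size_le). Qed.

Lemma card_set_le T : (#|T| <= k)%N.
Proof. by rewrite -[leqRHS]card_ord max_card. Qed.

Lemma densityE T :
  density D (induced H T) = exp_copies D (induced H T) / (n ^_ #|T|)%:R.
Proof. by rewrite /density card_sig bin_ffact. Qed.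

Lemma exp_copies_ge0 (V : finType) (P : sgraph V) : 0 <= exp_copies D P.
Proof. by apply: sumr_ge0 => G _; rewrite mulr_ge0 ?fdist_ge0. Qed.

Lemma exp_copy_prob_le_density T : exp_copy_prob T <= density D (induced H T).
Proof.
rewrite densityE exp_copy_probE ler_wpM2l ?exp_copies_ge0 //.
rewrite lef_pV2 ?posrE ?ffact_natr_gt0 ?card_set_le //.
by rewrite -natrX ler_nat ffact_le_exp.
Qed.

(** Densities normalise by the number of injective maps, probabilities by that of all maps; the
    ratio is at most [k ^ k]. *)
Lemma density_le_exp_copy_prob T :
  density D (induced H T) <= (k ^ k)%:R * exp_copy_prob T.
Proof.
rewrite densityE exp_copy_probE mulrCA ler_wpM2l ?exp_copies_ge0 //.
rewrite ler_pdivlMr // mulrC ler_pdivrMr ?ffact_natr_gt0 ?card_set_le //.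
rewrite -natrX -natrM ler_nat (leq_trans (exp_le_ffact _ motif_size_le)) //.
  exact: card_set_le.
by rewrite leq_mul // leq_pexp2l // card_set_le.
Qed.

Lemma density_gt0 T : 0 < density D (induced H T).
Proof. exact: lt_le_trans (exp_copy_prob_gt0 T) (exp_copy_prob_le_density T). Qed.

Lemma density_le1 T : density D (induced H T) <= 1.
Proof.
rewrite densityE ler_pdivrMr ?ffact_natr_gt0 ?card_set_le // mul1r.
by have := exp_copies_le_ffact (induced H T); rewrite card_sig.
Qed.

Lemma density_set0 : density D (induced H finset.set0) = 1.
Proof.
have := exp_copy_prob_set0.
by rewrite densityE exp_copy_probE finset.cards0 ffactn0 expr0.
Qed.

Lemma le_max_sub_density_sq S T :
  T \subset S ->
  density D (induced H T) ^+ 2 <= max_sub_density_sq D H S #|T|.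
Proof.
move=> TS; apply: sup_ubound; last by exists T.
exists 1 => _ [U _ <-].
by rewrite exprn_ile1 ?density_le1 // ltW ?density_gt0.
Qed.

Lemma max_sub_density_sq_gt0 S l : (l <= #|S|)%N -> 0 < max_sub_density_sq D H S l.
Proof.
move=> lS.
have [T TS Tl] : exists2 T : {set 'I_k}, T \subset S & #|T| = l.
  by move: lS; rewrite -bin_gt0 -cards_draws => /card_gt0P[T];
    rewrite inE => /andP[TS /eqP]; exists T.
rewrite -Tl; apply: lt_le_trans (le_max_sub_density_sq TS).
by rewrite exprn_gt0 ?density_gt0.
Qed.

Lemma density_incr_le S :
  density_incr D H #|S|
    <= density D (induced H S) ^+ 2 / max_sub_density_sq D H S #|S|.-1.
Proof.
apply: inf_lbound; last by exists S.
exists 0 => _ [U /= US <-].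
by rewrite divr_ge0 ?sqr_ge0 // ltW // max_sub_density_sq_gt0 // US leq_pred.
Qed.

(** Only the full vertex set has [k] elements, so the infimum is over a single positive quotient. *)
Lemma density_incr_gt0 : 0 < density_incr D H k.
Proof.
rewrite /density_incr.
rewrite (_ : [set S : {set 'I_k} | _]%classic = [set [set: 'I_k]%SET]%classic).
  by rewrite image_set1 inf1 divr_gt0 ?exprn_gt0 ?density_gt0 //
    max_sub_density_sq_gt0 // cardsT card_ord leq_pred.
apply/seteqP; split=> S /=; last by move=> ->; rewrite cardsT card_ord.
move=> Sk; apply/eqP; rewrite eqEcard finset.subsetT cardsT card_ord.
by rewrite Sk leqnn.
Qed.

Hypothesis incr_decay : forall l : nat, (2 <= l <= k)%N ->
  density_incr D H l <= 4 / 9 * density_incr D H l.-1.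

(** As [4 / 9 < 1], the increments decrease with [l]; the descending induction carries the positive
    lower bound [density_incr D H k]. *)
Lemma density_incr_min l :
  (0 < l <= k)%N -> density_incr D H k <= density_incr D H l.
Proof.
move=> /andP[l0 lk]; have [d] : exists d, (l + d)%N = k.
  by exists (k - l)%N; rewrite subnKC.
elim: d l l0 {lk} => [|d IH] l l0 ldk.
  by have -> : l = k by rewrite -ldk addn0.
have IHl : density_incr D H k <= density_incr D H l.+1.
  by apply: IH; rewrite // addSnnS.
have /incr_decay /= : (2 <= l.+1 <= k)%N.
  by rewrite ltnS l0 -ldk addnS ltnS leq_addr.
by have := density_incr_gt0; lra.
Qed.

Definition incr_inv : R := (density_incr D H k)^-1.

(** One link of the telescope: the increment at size [#|T|] is at least that at size [k], and its
    denominator dominates the squared density of [T :\ i]. *)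
Lemma density_sq_setD1 T i : i \in T ->
  density D (induced H (T :\ i)) ^+ 2
    <= incr_inv * density D (induced H T) ^+ 2.
Proof.
move=> iT; have cT : #|T :\ i| = #|T|.-1 by rewrite (cardsD1 i T) iT.
have T0 : (0 < #|T|)%N by rewrite card_gt0; apply/set0Pn; exists i.
have le_incr : density_incr D H k <= density_incr D H #|T|.
  by apply: density_incr_min; rewrite T0 card_set_le.
have := le_trans le_incr (density_incr_le T).
rewrite ler_pdivlMr; last by rewrite max_sub_density_sq_gt0 ?leq_pred.
rewrite /incr_inv ler_pdivlMl ?density_incr_gt0 //.
apply: le_trans; rewrite ler_pM2l ?density_incr_gt0 // -cT.
exact/le_max_sub_density_sq/subD1set.
Qed.

Lemma incr_inv_gt0 : 0 < incr_inv.
Proof. by rewrite invr_gt0 density_incr_gt0. Qed.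

Lemma density_sq_setD T J : J \subset T ->
  density D (induced H (T :\: J)) ^+ 2
    <= incr_inv ^+ #|J| * density D (induced H T) ^+ 2.
Proof.
move Jm: #|J| => m; elim: m J Jm => [|m IH] J Jm JT.
  by move/eqP: Jm; rewrite cards_eq0 => /eqP ->; rewrite finset.setD0 expr0 mul1r.
have /set0Pn[i iJ] : J != finset.set0 by rewrite -card_gt0 Jm.
have Jm' : #|J :\ i| = m by have := cardsD1 i J; rewrite iJ Jm => -[].
have JT' : J :\ i \subset T by apply: fintype.subset_trans (subD1set _ _) JT.
have -> : T :\: J = (T :\: (J :\ i)) :\ i.
  by rewrite finset.setDDl finset.setUC finset.setD1K.
apply: le_trans (density_sq_setD1 _) _.
  by rewrite !inE eqxx (fintype.subsetP JT).
by rewrite (exprS _ m) -mulrA ler_pM2l ?incr_inv_gt0 // IH.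
Qed.

(** Deleting all vertices of [H] leaves density 1, hence [1 <= incr_inv ^+ k] because densities are
    at most 1. *)
Lemma incr_inv_ge1 : 1 <= incr_inv.
Proof.
have := density_sq_setD (fintype.subxx [set: 'I_k]%SET).
rewrite finset.setDv density_set0 expr1n cardsT card_ord => Qk.
rewrite leNgt; apply/negP => Q1.
have Qk1 : incr_inv ^+ k < 1 by rewrite exprn_ilt1 ?ltW ?incr_inv_gt0 // -lt0n.
suff : incr_inv ^+ k * density D (induced H [set: 'I_k]%SET) ^+ 2 < 1 by lra.
apply: le_lt_trans Qk1; rewrite ler_piMr ?exprn_ge0 ?(ltW incr_inv_gt0) //.
by rewrite exprn_ile1 ?density_le1 // ltW ?density_gt0.
Qed.

(** The telescope bounds squared densities by [incr_inv ^+ #|J|]. Since [incr_inv] is at least 1,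
    squaring this factor only weakens the bound and avoids square roots. *)
Lemma exp_copy_prob_setD T J : J \subset T ->
  exp_copy_prob (T :\: J) <= (k ^ k)%:R * incr_inv ^+ #|J| * exp_copy_prob T.
Proof.
move=> JT; have QJ1 : 1 <= incr_inv ^+ #|J| by rewrite exprn_ege1 ?incr_inv_ge1.
have QJ0 : 0 <= incr_inv ^+ #|J| := le_trans ler01 QJ1.
have F0 U := ltW (density_gt0 U).
apply: (@le_trans _ _ (incr_inv ^+ #|J| * density D (induced H T))).
  apply: le_trans (exp_copy_prob_le_density _) _.
  rewrite -ler_sqr ?nnegrE //; last exact: mulr_ge0.
  apply: le_trans (density_sq_setD JT) _.
  rewrite [leRHS]exprMn ler_wpM2r ?sqr_ge0 // [leRHS]expr2 ler_peMl //.
rewrite [leRHS]mulrAC [leRHS]mulrC ler_wpM2l //.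
exact: density_le_exp_copy_prob.
Qed.

End Density.

(** * Non-adaptive algorithms as query trees *)

Section Simulation.
Variables (n : nat) (X : finType) (loc : X -> 'I_n * 'I_n).

Definition answers (G : sgraph 'I_n) : {ffun X -> bool} :=
  [ffun x => adj G (loc x).1 (loc x).2].

(** Both subtrees continue with the same queries and differ only in the answer recorded in [acc]. *)
Fixpoint ask (f : {ffun X -> bool} -> bool) (qs : seq X)
    (acc : {ffun X -> bool}) : query_tree n :=
  if qs is x :: qs' then
    Query (loc x).1 (loc x).2
      (ask f qs' [ffun y => if y == x then true else acc y])
      (ask f qs' [ffun y => if y == x then false else acc y])
  else Output n (f acc).

Lemma run_ask f qs acc G :
  run (ask f qs acc) G = f [ffun y => if y \in qs then answers G y else acc y].
Proof.
elim: qs acc => [|x qs IH] acc /=.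
  by congr f; apply/ffunP => y; rewrite ffunE.
transitivity
    (run (ask f qs [ffun y => if y == x then answers G x else acc y]) G).
  by rewrite /answers ffunE; case: (adj _ _ _).
rewrite IH; congr f; apply/ffunP => y; rewrite !ffunE in_cons.
by have [->|] := eqVneq y x; case: (_ \in qs).
Qed.

Lemma num_queries_ask f qs acc G : num_queries (ask f qs acc) G = size qs.
Proof. by elim: qs acc => //= x qs IH acc; case: ifP; rewrite IH. Qed.

(* The answers are decoded by picking any graph compatible with them. *)
Definition simulate (g : sgraph 'I_n -> bool) : query_tree n :=
  ask (fun b => if [pick G | answers G == b] is Some G then g G else false)
      (enum X) [ffun=> false].

Lemma run_simulate g G :
  (forall G1 G2, answers G1 = answers G2 -> g G1 = g G2) ->
  run (simulate g) G = g G.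
Proof.
move=> gP; rewrite run_ask.
have -> : [ffun y => if y \in enum X then answers G y else [ffun=> false] y]
    = answers G by apply/ffunP => y; rewrite ffunE mem_enum.
by case: pickP => [G' /eqP/gP|/(_ G)] //; rewrite eqxx.
Qed.

Lemma num_queries_simulate g G : num_queries (simulate g) G = #|X|.
Proof. by rewrite num_queries_ask -cardE. Qed.

End Simulation.

(** * Uniform coins and acceptance probabilities *)

Section UniformDistribution.
Variables (R : realType) (W : finType).
Hypothesis W_gt0 : (0 < #|W|)%N.

Definition uniform_dist : fdist R W.
Proof.
apply: (@FDist R W (fun=> #|W|%:R^-1)) => [x|]; first by rewrite invr_ge0.
have := @avg_cst R W 1 W_gt0.
by rewrite /avg mulr_suml; under eq_bigr do rewrite mul1r.
Defined.

Lemma Pr_uniform (P : pred W) : Pr uniform_dist P = avg (fun w => (P w)%:R).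
Proof.
rewrite /Pr /avg big_mkcond mulr_suml; apply: eq_bigr => w _.
by case: (P w); rewrite ?mul1r ?mul0r.
Qed.

End UniformDistribution.

Lemma sum_pair_Pr (R : realType) (X W : finType) (D : fdist R X)
    (mu : fdist R W) (A : W -> X -> bool) :
  \sum_(p : X * W | A p.2 p.1) D p.1 * mu p.2 =
    expect D (fun x => Pr mu (A^~ x)).
Proof.
rewrite -(pair_big_dep xpredT (fun x w => A w x) (fun x w => D x * mu w)) /=.
by apply: eq_bigr => x _; rewrite mulr_sumr.
Qed.

Lemma expect_ge_Pr (R : realType) (X : finType) (D : fdist R X) (P : pred X)
    (f : X -> R) (t : R) :
  (forall x, 0 <= f x) -> (forall x, P x -> t <= f x) ->
  t * Pr D P <= expect D f.
Proof.
move=> f0 ft; rewrite /Pr /expect big_mkcond mulr_sumr; apply: ler_sum => x _.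
case: ifP => [/ft tf|_]; last by rewrite mulr0 mulr_ge0 ?fdist_ge0.
by rewrite mulrC ler_wpM2l ?fdist_ge0.
Qed.

(** * Acceptance thresholds for a single estimate *)

(** Allowed error of an estimate relative to [Num.max p e]. The value makes the error at most
    [eps / 4 * e] as long as [p <= (1 + eps) * e]; the maximum keeps it positive for [p = 0] and
    scales it when [p] is huge. *)
Definition rel_gap (R : realType) (eps : R) : R := eps / (4 * (1 + eps)).

Section RelativeGap.
Variables (R : realType) (eps e p z : R).
Hypotheses (eps_gt0 : 0 < eps) (e_gt0 : 0 < e).

Lemma rel_gap_gt0 : 0 < rel_gap eps.
Proof. by rewrite divr_gt0 // mulr_gt0 // addr_gt0. Qed.

Lemma rel_gapM : rel_gap eps * (1 + eps) = eps / 4.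
Proof. by rewrite /rel_gap; field; rewrite lt0r_neq0 // addr_gt0. Qed.

Lemma close_accept : `|p - e| <= eps / 100 * e ->
  `|z - p| < rel_gap eps * Num.max p e -> `|z - e| <= eps / 2 * e.
Proof.
move=> pe zp; have ee := mulr_gt0 eps_gt0 e_gt0.
have gm : rel_gap eps * Num.max p e <= eps / 4 * e.
  rewrite -rel_gapM -mulrA ler_pM2l ?rel_gap_gt0 // ge_max.
  by move: pe; rewrite ler_distl => /andP[_ ?]; apply/andP; split; lra.
by have := ler_distD p z e; lra.
Qed.

Lemma far_reject : eps * e < `|p - e| -> `|z - e| <= eps / 2 * e ->
  rel_gap eps * Num.max p e <= `|z - p|.
Proof.
move=> pe; rewrite ler_distl => /andP[z1 z2].
have ee := mulr_gt0 eps_gt0 e_gt0; have g0 := rel_gap_gt0; have gM := rel_gapM.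
have ge0 := mulr_gt0 g0 eps_gt0.
have [p_le|e_lt] := leP p e.
  rewrite ler0_norm ?subr_le0 // in pe.
  rewrite real_ler_normr ?num_real //; apply/orP; left.
  have : rel_gap eps * e <= eps / 4 * e by rewrite ler_pM2r //; lra.
  lra.
rewrite gtr0_norm ?subr_gt0 // in pe.
rewrite real_ler_normr ?num_real //; apply/orP; right.
(* The goal amounts to [z <= (1 - rel_gap eps) * p]. The right side increases with [p], so it
   suffices to compare at [p = (1 + eps) * e]. *)
have g1 : 0 < 1 - rel_gap eps.
  by rewrite subr_gt0 ltr_pdivrMr ?mulr_gt0 ?addr_gt0 //; lra.
have : (1 + eps) * e * (1 - rel_gap eps) <= p * (1 - rel_gap eps).
  by rewrite ler_pM2r //; lra.
have -> : (1 + eps) * e * (1 - rel_gap eps) =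
    (1 + eps) * e - rel_gap eps * (1 + eps) * e by ring.
by rewrite gM; lra.
Qed.

End RelativeGap.

(* Chosen so that Chebyshev's inequality bounds the failure probability of each
   of the 2 ^ k estimates by 1 / (4 * 2 ^ k). *)
Definition sample_const (R : realType) (k : nat) (eps : R) : R :=
  (1 + eps) * (k ^ k)%:R * (2 ^ k)%:R * (4 * (2 ^ k)%:R) / rel_gap eps ^+ 2 + 1.

Lemma sample_const_ge1 (R : realType) (k : nat) (eps : R) :
  0 < eps -> 1 <= sample_const k eps.
Proof.
move=> eps_gt0; rewrite lerDr divr_ge0 ?sqr_ge0 // !mulr_ge0 ?ler0n //.
by rewrite addr_ge0 // ltW.
Qed.

Lemma card_sets (T : finType) : #|{: {set T}}| = (2 ^ #|T|)%N.
Proof. by have := card_powerset [set: T]%SET; rewrite powersetT !cardsT. Qed.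

(** * The tester, its completeness and its soundness *)

Section Tester.
Variables (R : realType) (k n s : nat) (H : sgraph 'I_k) (eps : R).
Variable D : fdist R (sgraph 'I_n).
Hypotheses (k_gt0 : (0 < k)%N) (eps_gt0 : 0 < eps).
Hypothesis EH_gt0 : 0 < exp_copies D H.
Hypothesis incr_decay : forall l : nat, (2 <= l <= k)%N ->
  density_incr D H l <= 4 / 9 * density_incr D H l.-1.
Hypothesis s_large : sample_const k eps * incr_inv H D <= s%:R.
Implicit Types (T U J : {set 'I_k}) (G : sgraph 'I_n).
Implicit Type w : {ffun 'I_k * 'I_s -> 'I_n}.

Local Notation e := (exp_copy_prob H D).
Local Notation p := (copy_prob R H).
Local Notation Z G := (@estimate R 'I_k 'I_n 'I_s (copy_on H G)).
Local Notation K := (sample_const k eps).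
Local Notation Q := (incr_inv H D).
Local Notation c := (rel_gap eps).

Let n_gt0 : (0 < #|'I_n|)%N.
Proof. by rewrite card_ord (leq_trans k_gt0) // (motif_size_le EH_gt0). Qed.

Let c_gt0 : 0 < c. Proof. exact: rel_gap_gt0. Qed.

Let K_ge1 : 1 <= K. Proof. exact: sample_const_ge1. Qed.

Let Q_ge1 : 1 <= Q. Proof. exact: incr_inv_ge1. Qed.

Let s_gt0 : 0 < s%:R :> R.
Proof. by apply: lt_le_trans s_large; rewrite mulr_gt0 // (lt_le_trans ltr01). Qed.

Let S_gt0 : (0 < #|'I_s|)%N.
Proof. by rewrite card_ord -(ltr0n R). Qed.

Let e_gt0 T : 0 < e T. Proof. exact: exp_copy_prob_gt0. Qed.

(** Since [K >= 1], the ratio [Q / s] is at most 1, so its powers are largest at [j = 1]. All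
    agreement sets thus get the same bound. *)
Lemma sample_ratio j : (0 < j)%N -> Q ^+ j / s%:R ^+ j <= K^-1.
Proof.
move=> j0; have K0 : 0 < K := lt_le_trans ltr01 K_ge1.
have Q0 : 0 <= Q := le_trans ler01 Q_ge1.
have QsK : Q / s%:R <= K^-1.
  by rewrite ler_pdivrMr // mulrC ler_pdivlMr // mulrC.
rewrite -expr_div_n; apply: le_trans QsK.
rewrite ler_iXnr // ?divr_ge0 //.
by rewrite ler_pdivrMr // mul1r (le_trans _ s_large) // ler_peMl.
Qed.

(** Only proper subsets need to be controlled: the variance involves [T] itself and the sets
    [T :\: J] with [J] nonempty. A large [p G T] is absorbed by the maximum in the threshold. *)
Lemma estimate_tail G T :
  (forall U, U \proper T -> p G U <= (1 + eps) * e U) ->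
  avg (fun w => (c * Num.max (p G T) (e T) <= `|Z G T w - p G T|)%R%:R)
    <= (4 * (2 ^ k)%:R)^-1 :> R.
Proof.
move=> small; set m := Num.max _ _.
have m0 : 0 < m by rewrite lt_max e_gt0 orbT.
have K0 : 0 < K := lt_le_trans ltr01 K_ge1.
have pm : p G T <= m by rewrite le_max lexx.
have em : e T <= m by rewrite le_max lexx orbT.
have eps1 : 0 <= 1 + eps by rewrite addr_ge0 // ltW.
apply: le_trans (chebyshev_avg _ _ (mulr_gt0 c_gt0 m0)) _.
rewrite ler_pdivrMr; last exact/exprn_gt0/mulr_gt0.
apply: le_trans (variance_estimate R n_gt0 S_gt0 (@copy_on_local _ _ H G)
  (@copy_on_mono _ _ H G) T) _.
pose b := m ^+ 2 * ((1 + eps) * (k ^ k)%:R) / K.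
have b'0 : 0 <= m ^+ 2 * ((1 + eps) * (k ^ k)%:R).
  by rewrite mulr_ge0 ?sqr_ge0 // mulr_ge0.
have b0 : 0 <= b by rewrite divr_ge0 ?(ltW K0).
(* [b] bounds every variance term, and the sum is extended to all [2 ^ k] sets, which accounts for
   one factor [2 ^ k] in [sample_const]. *)
apply: (@le_trans _ _ (\sum_(J : {set 'I_k}) b)).
  rewrite [leLHS]big_mkcond; apply: ler_sum => J _; case: ifP => // /andP[J0 JT].
  have proJ : T :\: J \proper T.
    rewrite properE finset.subsetDl /=; apply/negP => /fintype.subsetP TJ.
    have /set0Pn[i iJ] := J0; have := TJ i (fintype.subsetP JT i iJ).
    by rewrite inE iJ.
  have pJ : p G (T :\: J) <= (1 + eps) * ((k ^ k)%:R * Q ^+ #|J| * m).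
    apply: le_trans (small _ proJ) _; rewrite ler_wpM2l //.
    apply: le_trans (exp_copy_prob_setD EH_gt0 k_gt0 incr_decay JT) _.
    rewrite ler_wpM2l // mulr_ge0 // exprn_ge0 //.
    exact: le_trans Q_ge1.
  have p0 U : 0 <= p G U by apply: hit_prob_ge0.
  rewrite card_ord; apply: (@le_trans _ _
      (m * ((1 + eps) * ((k ^ k)%:R * Q ^+ #|J| * m)) / s%:R ^+ #|J|)).
    by rewrite ler_wpM2r ?invr_ge0 ?exprn_ge0 // ler_pM //; apply: p0.
  have -> : m * ((1 + eps) * ((k ^ k)%:R * Q ^+ #|J| * m)) / s%:R ^+ #|J| =
      m ^+ 2 * ((1 + eps) * (k ^ k)%:R) * (Q ^+ #|J| / s%:R ^+ #|J|) by ring.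
  by rewrite ler_wpM2l ?sample_ratio ?card_gt0.
rewrite sumr_const -(mulr_natr b) card_sets card_ord.
have KB : (1 + eps) * (k ^ k)%:R * (2 ^ k)%:R * (4 * (2 ^ k)%:R) <= K * c ^+ 2.
  by rewrite -ler_pdivrMr ?exprn_gt0 // /sample_const lerDl.
have N0 : 0 < 4 * (2 ^ k)%:R :> R by rewrite mulr_gt0 // ltr0n expn_gt0.
rewrite [leRHS]mulrC ler_pdivlMr //.
have -> : b * (2 ^ k)%:R * (4 * (2 ^ k)%:R) = m ^+ 2 *
    ((1 + eps) * (k ^ k)%:R * (2 ^ k)%:R * (4 * (2 ^ k)%:R)) / K.
  by rewrite /b; ring.
rewrite ler_pdivrMr //.
have -> : (c * m) ^+ 2 * K = m ^+ 2 * (K * c ^+ 2) by ring.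
by rewrite ler_wpM2l ?sqr_ge0.
Qed.

(** All [T] are tested: if a proper subgraph is too frequent in [G], the estimate for the full
    vertex set may be unreliable. *)
Definition accepts w G : bool :=
  [forall T, `|Z G T w - e T| <= eps / 2 * e T].

(** The estimates read only adjacencies between sampled vertices. *)
Lemma accepts_ext w G1 G2 :
  answers (fun q => (w q.1, w q.2)) G1 = answers (fun q => (w q.1, w q.2)) G2 ->
  accepts w G1 = accepts w G2.
Proof.
move=> /ffunP E; apply: eq_forallb => T.
suff -> : Z G1 T w = Z G2 T w by [].
apply: eq_avg => a; congr (_%:R); congr nat_of_bool.
rewrite /copy_on /is_copy; congr andb.
apply: eq_forallb => u; apply: eq_forallb => v.
have := E ((val u, a (val u)), (val v, a (val v))).
by rewrite !ffunE /= => ->.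
Qed.

Lemma accepts_complete G :
  (forall T, `|p G T - e T| <= eps / 100 * e T) ->
  3 / 4 <= avg (fun w => (accepts w G)%:R) :> R.
Proof.
move=> close.
pose bad T w := c * Num.max (p G T) (e T) <= `|Z G T w - p G T|.
have small T U : U \proper T -> p G U <= (1 + eps) * e U.
  move=> _; have := close U; rewrite ler_distl => /andP[_].
  by have := mulr_gt0 eps_gt0 (e_gt0 U); lra.
have W0 : (0 < #|{ffun 'I_k * 'I_s -> 'I_n}|)%N by rewrite card_ffun_gt0.
(* Union bound in averaged form: each [w] is accepted or is bad for some [T]. *)
have : 1 <= avg (fun w => (accepts w G)%:R + \sum_T (bad T w)%:R) :> R.
  rewrite -[leLHS](@avg_cst R _ 1 W0); apply: le_avg => w.
  have [[T bT]|nbad] := altP (@existsP _ (bad^~ w)).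
    rewrite (bigD1 T) //= bT addrCA lerDl addr_ge0 ?ler0n //.
    by rewrite sumr_ge0.
  suff -> : accepts w G by rewrite lerDl sumr_ge0.
  apply/forallP => T; apply: (close_accept eps_gt0 (e_gt0 T) (close T)).
  by move: nbad; rewrite negb_exists => /forallP/(_ T); rewrite -ltNge.
rewrite avgD avg_sum.
have : \sum_T avg (fun w => (bad T w)%:R) <= 4^-1 :> R.
  apply: (@le_trans _ _ (\sum_(T : {set 'I_k}) (4 * (2 ^ k)%:R)^-1)).
    by apply: ler_sum => T _; apply: estimate_tail => U; apply: small.
  rewrite sumr_const card_sets card_ord -[_ *+ _]mulr_natr invfM -mulrA.
  by rewrite mulVf ?mulr1 // pnatr_eq0 -lt0n expn_gt0.
lra.
Qed.

Lemma accepts_sound G :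
  eps < `|quality D H G - 1| ->
  3 / 4 <= avg (fun w => (~~ accepts w G)%:R) :> R.
Proof.
move=> badH.
(* The normalisation by [n ^ k] cancels in [p / e], so the quality is this ratio at the full vertex
   set. *)
have badT : eps * e [set: 'I_k]%SET < `|p G [set: 'I_k]%SET - e [set: 'I_k]%SET|.
  rewrite -ltr_pdivlMr //.
  rewrite -[X in _ / X]gtr0_norm // -normf_div mulrBl divff ?lt0r_neq0 //.
  rewrite exp_copy_prob_setT copy_prob_setT // !card_ord.
  move: badH; rewrite /quality; congr (_ < `|_ - 1|).
  rewrite invfM invrK mulrACA mulVf ?mulr1 // expf_neq0 // pnatr_eq0 -lt0n.
  by move: n_gt0; rewrite card_ord.
have [T small badT'] : exists2 T : {set 'I_k},
    forall U, U \proper T -> p G U <= (1 + eps) * e U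
    & eps * e T < `|p G T - e T|.
  (* A minimal high set has no high proper subset. If no set is high, the full vertex set serves,
     being far from its expectation by [badT]. *)
  pose high := [pred T : {set 'I_k} | (1 + eps) * e T < p G T].
  have [T0 highT0|nhigh] := pickP high; last first.
    by exists [set: 'I_k]%SET => // U _; rewrite leNgt; apply/negbT/nhigh.
  have [T /minsetP[highT minT] _] := minset_exists highT0.
  exists T => [U UT|]; last by rewrite ltr_normr; move: highT => /= ?; lra.
  rewrite leNgt; apply/negP => highU.
  have := minT U highU (proper_sub UT) => UTE.
  by rewrite UTE fintype.properxx in UT.
have W0 : (0 < #|{ffun 'I_k * 'I_s -> 'I_n}|)%N by rewrite card_ffun_gt0.
pose bad w := c * Num.max (p G T) (e T) <= `|Z G T w - p G T|.
have : 1 <= avg (fun w => (~~ accepts w G)%:R + (bad w)%:R) :> R.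
  rewrite -[leLHS](@avg_cst R _ 1 W0); apply: le_avg => w.
  case: (boolP (accepts w G)) => [/forallP/(_ T) acc|_]; last by rewrite lerDl.
  suff -> : bad w by rewrite add0r.
  exact: far_reject eps_gt0 (e_gt0 T) badT' acc.
rewrite avgD; have := estimate_tail small; rewrite -/bad.
have : (4 * (2 ^ k)%:R)^-1 <= 4^-1 :> R.
  by rewrite lef_pV2 ?posrE ?mulr_gt0 ?ltr0n ?expn_gt0 // ler_peMr // ler1n
    expn_gt0.
lra.
Qed.
End Tester.

(** * From concentrated counts to the algorithm *)

Lemma concentrated_copy_prob (R : realType) (k n : nat) (H : sgraph 'I_k)
    (D : fdist R (sgraph 'I_n)) (eps : R) (G : sgraph 'I_n) :
  (0 < k)%N -> 0 < eps -> 0 < exp_copies D H ->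
  [forall S : {set 'I_k}, (1 <= #|S| <= k)%N ==>
    (`|(num_copies (induced H S) G)%:R - exp_copies D (induced H S)|
       <= eps / 100 * exp_copies D (induced H S))] ->
  forall T, `|copy_prob R H G T - exp_copy_prob H D T|
    <= eps / 100 * exp_copy_prob H D T.
Proof.
move=> k0 eps0 EH0 /forallP conc T.
have n0 : (0 < n)%N := leq_trans k0 (motif_size_le EH0).
(* The concentration hypothesis excludes the empty set, where the probability is identically 1. *)
have [->|T0] := eqVneq T finset.set0.
  rewrite copy_prob_set0 ?card_ord // exp_copy_prob_set0 // subrr normr0 mulr1.
  by rewrite divr_ge0 // ltW.
move: (conc T); rewrite card_gt0 T0 card_set_le /= => concT.
have nT : 0 < n%:R ^+ #|T| :> R by rewrite exprn_gt0 // ltr0n.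
rewrite copy_probE ?card_ord // exp_copy_probE // -mulrBl normrM.
by rewrite [X in _ * X]gtr0_norm ?invr_gt0 // mulrA ler_pM2r ?invr_gt0.
Qed.

Theorem theorem5p2 (R : realType) (k : nat) (H : sgraph 'I_k) (eps : R)
    (k_gt0 : (0 < k)%N) (eps_gt0 : 0 < eps) :
  exists (C : R) (c : nat), forall (n : nat) (D : fdist R (sgraph 'I_n)),
    0 < exp_copies D H ->
    quality_promise D (quality D H) eps ->
    counts_concentrated D H eps ->
    (forall l : nat, (2 <= l <= k)%N ->
       density_incr D H l <= 4 / 9 * density_incr D H l.-1) ->
    exists A : query_alg R n,
      quality_control D (quality D H) eps (coin_dist A)
        (fun w => run (strategy A w)) /\
      (forall (w : coins A) (G : sgraph 'I_n),
         (num_queries (strategy A w) G)%:R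
           <= soft_bound C c (density_incr D H k ^- 2)).
Proof.
pose K := sample_const k eps.
(* The tester asks [(k * s) ^ 2] queries with [s <= K * Q + 1 <= (K + 1) * Q], by [1 <= Q]. [K]
   depends only on [k] and [eps], and the exponent 0 removes the logarithm. *)
exists (k%:R ^+ 2 * (K + 1) ^+ 2), 0%N => n D EH_gt0 _ conc decay.
have n_gt0 : (0 < n)%N := leq_trans k_gt0 (motif_size_le EH_gt0).
pose Q := incr_inv H D.
have Q1 : 1 <= Q by apply: incr_inv_ge1.
have K1 : 1 <= K by apply: sample_const_ge1.
have KQ0 : 0 <= K * Q by rewrite mulr_ge0 // (le_trans ler01).
pose s := (Num.truncn (K * Q)).+1.
have /andP[s_le s_gt] := truncn_itv KQ0.
have s_large : K * Q <= s%:R by apply: ltW.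
have W0 : (0 < #|{ffun 'I_k * 'I_s -> 'I_n}|)%N.
  by rewrite card_ffun_gt0 ?card_ord.
pose A := QueryAlg (uniform_dist R W0)
  (fun w => simulate (fun q => (w q.1, w q.2)) (accepts H eps D w)).
have runA w G : run (strategy A w) G = accepts H eps D w G.
  by rewrite run_simulate // => G1 G2; apply: accepts_ext.
exists A; split; first split.
- rewrite [leRHS](sum_pair_Pr D (coin_dist A) (fun w => run (strategy A w))).
  (* Concentrated graphs have mass at least 9/10 and each is accepted with probability at least 3/4;
     the product 27/40 exceeds 2/3. *)
  apply: (@le_trans _ _ (3 / 4 * (9 / 10))); first by lra.
  apply: le_trans (ler_wpM2l _ conc) _; first by lra.
  apply: expect_ge_Pr => [G|G concG]; first by rewrite Pr_uniform avg_ge0.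
  rewrite Pr_uniform; under eq_avg do rewrite runA.
  exact/accepts_complete/concentrated_copy_prob.
- move=> G badG; rewrite Pr_uniform; under eq_avg do rewrite runA.
  apply: (@le_trans _ _ (3 / 4)); first by lra.
  exact: accepts_sound.
- move=> w G; rewrite num_queries_simulate !card_prod !card_ord.
  rewrite /soft_bound expr0 mulr1 -exprVn -[_^-1]/Q -exprMn -exprMn mulnn natrX.
  have ks_le : (k * s)%:R <= k%:R * (K + 1) * Q.
    rewrite natrM -mulrA ler_wpM2l // mulrDl mul1r.
    by rewrite /s -[_.+1%:R]natr1; exact: lerD.
  by rewrite lerXn2r ?nnegrE // (le_trans _ ks_le).
Qed.
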